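(* Let $a,b,\rho$ be real numbers with $a>0$, $b>0$, $\rho>0$, and suppose that $a+b \xrightarrow{\rho} a$ and $a \xrightarrow{\rho} b$ both hold. Then $$\rho=\Phi=\frac{1+\sqrt5}{2},$$ that is, $\Phi$ is the only positive real number that can occur as such a ratio.
   Context: For real numbers $x,y>0$ and $\rho>0$, put $m_\rho(x)=x/\rho$. One writes $x\xrightarrow{\rho}y$ when $m_\rho(x)=y$; equivalently $x/\rho=y$, equivalently $x/y=\rho$. The chain $a+b\xrightarrow{\rho}a\xrightarrow{\rho}b$ (a ''proportional resonance'') means that both $a+b\xrightarrow{\rho}a$ and $a\xrightarrow{\rho}b$ hold. *)

(* Defs.v *)
From Stdlib Require Import Reals.
Open Scope R_scope.

Definition m (rho x : R) : R := x / rho.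

(* The arrow is only meaningful for positive [x], [y] and [rho]; the positivity
   hypotheses are left to the statements that use it. *)
Definition arrow (rho x y : R) : Prop := m rho x = y.

Notation "x -[ rho ]-> y" := (arrow rho x y)
  (at level 70, rho at level 200, y at next level).

Definition Phi : R := (1 + sqrt 5) / 2.

(* Main.v *)
(** From [a = rho b] and [a + b = rho a] one gets [rho^2 = rho + 1], whose only
    positive root is [Phi]; conversely [(a, b) = (Phi, 1)] realises this ratio. *)

Require Import Defs.
From Stdlib Require Import Reals Lra.
Open Scope R_scope.

(** Eliminating [a] from the two arrows leaves a quadratic for [rho] alone, [rho * rho = rho + 1].
    Its roots have product -1, so only one is positive ([pos_root_eq_Phi]). *)

Lemma arrow_iff (rho x y : R) : rho <> 0 -> (x -[rho]-> y <-> x = y * rho).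
Proof.
  intros Hrho; unfold arrow, m; split.
  - intros <-; now field.
  - intros ->; now field.
Qed.

Lemma Phi_pos : 0 < Phi.
Proof. unfold Phi; assert (H := sqrt_pos 5); lra. Qed.

Lemma Phi_sqr : Phi * Phi = Phi + 1.
Proof.
  unfold Phi; assert (H : sqrt 5 * sqrt 5 = 5) by (apply sqrt_sqrt; lra).
  lra.
Qed.

(** Subtracting the equation of [Phi] from that of [r] gives a difference of squares that factors
    through [r - Phi]. *)
Lemma pos_root_eq_Phi (r : R) : 0 < r -> r * r = r + 1 -> r = Phi.
Proof.
  intros Hr Hroot.
  assert (HPhi := Phi_pos); assert (HPhi2 := Phi_sqr).
  (* The other factor is nonzero: [r + Phi = 1] would give [r * Phi = -1]. *)
  assert (Hfac : (r - Phi) * (r + Phi - 1) = 0) by lra.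
  destruct (Rmult_integral _ _ Hfac) as [H | H]; [lra |].
  assert (Hprod := Rmult_lt_0_compat _ _ Hr HPhi).
  replace Phi with (1 - r) in Hprod by lra.
  lra.
Qed.

Theorem proposition2p1p2 :
  (forall a b rho : R,
      0 < a -> 0 < b -> 0 < rho ->
      a + b -[rho]-> a -> a -[rho]-> b ->
      rho = Phi) /\
  (exists a b : R,
      0 < a /\ 0 < b /\ 0 < Phi /\
      a + b -[Phi]-> a /\ a -[Phi]-> b).
Proof.
  assert (HPhi := Phi_pos); assert (HPhi2 := Phi_sqr).
  split.
  - intros a b rho _ Hb Hrho Hab Ha.
    apply arrow_iff in Hab; [| lra].
    apply arrow_iff in Ha; [| lra].
    apply pos_root_eq_Phi; [exact Hrho |].
    (* With [a = b * rho], the first arrow is the quadratic scaled by [b]. *)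
    apply (Rmult_eq_reg_l b); [| lra].
    subst a; lra.
  (* With [b = 1] the second arrow forces [a = Phi]; the first is then [Phi_sqr]. *)
  - exists Phi, 1.
    rewrite !arrow_iff by lra.
    repeat split; lra.
Qed.
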